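(* The fully discrete upwind Lagrange multiplier scheme (S1)--(S9) described in the context preserves strict bounds on the cell averages $\phi_{i,j}$. That is, for every solution of the scheme and every time level $n\in\{0,\dots,N-1\}$: for all $i,j$, if $|\phi_{i,j}^{n}|<1$, then $|\phi_{i,j}^{n+1}|<1$.
   Context: Parameters: real numbers $0<\varepsilon\ll1$ (interface width), $\kappa>0$ (contact line mobility), time step $\Delta t>0$, spatial steps $\Delta x>0$, $\Delta y>0$, prescribed contact angle $\theta_s\in[0,\pi]$, and positive integers $N_x,N_y,N$. A rectangular domain is divided into cells indexed by $i=1,\dots,N_x$, $j=1,\dots,N_y$; the row $j=1$ is adjacent to the substrate $\Gamma_w$, and the other three sides form the non-substrate boundary $\Gamma_n$. $\phi_{i,j}^n$ denotes the (approximate) cell average of the phase variable at time $n\Delta t$. Potential: $F$ is one of the following. (Logarithmic Flory--Huggins) $F(\chi)=F_{log}(\chi)-F_{log}(\beta)$ with $F_{log}(\chi)=\frac{\theta}{2}[(1+\chi)\ln(1+\chi)+(1-\chi)\ln(1-\chi)]+\frac12(1-\chi^2)$, $0<\theta<1$, where $\beta\in(0,1)$ is the positive root of $F_{log}'(\chi)=\frac{\theta}{2}\ln\frac{1+\chi}{1-\chi}-\chi=0$; (Polynomial) $F(\chi)=\frac14(1-\chi^2)^2$, with $\beta=1$. Put $c_F=\int_{-\beta}^{\beta}\sqrt{2F(\chi)}\,d\chi$ and $g(\chi)=\frac{\varepsilon c_F\cos\theta_s}{4\beta^3}(\chi^3-3\beta^2\chi)$. Notation: $\chi^+=\max\{\chi,0\}$,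 $\chi^-=\min\{\chi,0\}$, and the two-state upwind mobility is $M(\chi_1,\chi_2)=(1+\chi_1)^+(1-\chi_2)^+$. Scheme: a solution consists of $\phi_{i,j}^n$ ($0\le n\le N$) and, for each $n=0,\dots,N-1$, values $\mu_{i,j}^{n+1}$, fluxes $J^{n+1}$, velocities $V^{n+1}$, scalars $\xi^{n+1},\eta^{n+1}$ (independent of $i,j$) and ghost values such that: (S1) $\phi_{i,j}^{n+1}-\phi_{i,j}^{n}=-\left[\frac{\Delta t}{\Delta x}(J_{i+\frac12,j}^{n+1}-J_{i-\frac12,j}^{n+1})+\frac{\Delta t}{\Delta y}(J_{i,j+\frac12}^{n+1}-J_{i,j-\frac12}^{n+1})\right]$ for all cells. (S2) $J_{i+\frac12,j}^{n+1}=(V_{i+\frac12,j}^{n+1})^+M(\phi_{i,j}^{n+1},\phi_{i+1,j}^{n+1})+(V_{i+\frac12,j}^{n+1})^-M(\phi_{i+1,j}^{n+1},\phi_{i,j}^{n+1})$, with $V_{i+\frac12,j}^{n+1}=-\frac{1}{\Delta x}(\mu_{i+1,j}^{n+1}-\mu_{i,j}^{n+1})$ (faces between two cells; boundary faces are covered by (S4)). (S3) $J_{i,j+\frac12}^{n+1}=(V_{i,j+\frac12}^{n+1})^+M(\phi_{i,j}^{n+1},\phi_{i,j+1}^{n+1})+(V_{i,j+\frac12}^{n+1})^-M(\phi_{i,j+1}^{n+1},\phi_{i,j}^{n+1})$, with $V_{i,j+\frac12}^{n+1}=-\frac{1}{\Delta y}(\mu_{i,j+1}^{n+1}-\mu_{i,j}^{n+1})$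 (faces between two cells; boundary faces are covered by (S4)). (S4) No flux: $J_{\frac12,j}^{n+1}=J_{N_x+\frac12,j}^{n+1}=0$ and $J_{i,\frac12}^{n+1}=J_{i,N_y+\frac12}^{n+1}=0$. (S5) $\mu_{i,j}^{n+1}=-\varepsilon^2(\Delta\phi)_{i,j}^{n+1}+\xi^{n+1}F'(\phi_{i,j}^{n+1})$. (S6) $(\Delta\phi)_{i,j}^{n+1}=\frac{\phi_{i+1,j}^{n+1}-2\phi_{i,j}^{n+1}+\phi_{i-1,j}^{n+1}}{\Delta x^2}+\frac{\phi_{i,j+1}^{n+1}-2\phi_{i,j}^{n+1}+\phi_{i,j-1}^{n+1}}{\Delta y^2}$. (S7) Ghost values (encoding the homogeneous Neumann condition on $\Gamma_n$ and the dynamic contact line condition $\phi_{i,1}^{n+1}-\phi_{i,1}^{n}=-\kappa\Delta t\,(-\varepsilon^2\frac{\phi_{i,1}^{n+1}-\phi_{i,0}^{n+1}}{\Delta y}+\eta^{n+1}g'(\phi_{i,1}^{n+1}))$ on $\Gamma_w$): $\phi_{0,j}^{n+1}=\phi_{1,j}^{n+1}$, $\phi_{N_x+1,j}^{n+1}=\phi_{N_x,j}^{n+1}$, $\phi_{i,N_y+1}^{n+1}=\phi_{i,N_y}^{n+1}$, and $\phi_{i,0}^{n+1}=\left(1-\frac{\Delta y}{\varepsilon^2\kappa\Delta t}\right)\phi_{i,1}^{n+1}+\frac{\Delta y}{\varepsilon^2\kappa\Delta t}\phi_{i,1}^{n}-\frac{\Delta y}{\varepsilon^2}\eta^{n+1}g'(\phi_{i,1}^{n+1})$.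 (S8) $\sum_{i=1}^{N_x}\sum_{j=1}^{N_y}(F(\phi_{i,j}^{n+1})-F(\phi_{i,j}^{n}))=\xi^{n+1}\sum_{i=1}^{N_x}\sum_{j=1}^{N_y}F'(\phi_{i,j}^{n+1})(\phi_{i,j}^{n+1}-\phi_{i,j}^{n})$. (S9) $\sum_{i=1}^{N_x}(g(\phi_{i,1}^{n+1})-g(\phi_{i,1}^{n}))=\eta^{n+1}\sum_{i=1}^{N_x}g'(\phi_{i,1}^{n+1})(\phi_{i,1}^{n+1}-\phi_{i,1}^{n})$. *)

(* Defs.v *)
From Stdlib Require Import Reals Lra Lia.
From Coquelicot Require Import Coquelicot.
Open Scope R_scope.

(** Stdlib reals with Coquelicot's total [Derive] and [RInt]. *)

(** [ln] is [0] on nonpositive reals, so [Flog theta] is the usual continuous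
    function on [[-1, 1]] (with [0 ln 0 = 0]) and is also given a value
    elsewhere. *)
Definition Flog (theta x : R) : R :=
  theta / 2 * ((1 + x) * ln (1 + x) + (1 - x) * ln (1 - x))
  + / 2 * (1 - x ^ 2).

Lemma Derive_Flog (theta x : R) (hx : -1 < x < 1) :
  Derive (Flog theta) x = theta / 2 * ln ((1 + x) / (1 - x)) - x.
Proof.
  apply is_derive_unique; unfold Flog; auto_derive.
  - repeat split; lra.
  - rewrite ln_div by lra. unfold Rminus. field; lra.
Qed.

Definition Fpoly (x : R) : R := / 4 * (1 - x ^ 2) ^ 2.

Inductive is_potential : (R -> R) -> R -> Prop :=
| flory_huggins (theta beta : R) :
    0 < theta < 1 -> 0 < beta < 1 -> Derive (Flog theta) beta = 0 ->
    is_potential (fun x => Flog theta x - Flog theta beta) beta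
| polynomial : is_potential Fpoly 1.

Record parameters := {
  eps : R;
  kappa : R;
  theta_s : R;
  dt : R;
  dx : R;
  dy : R;
  Nx : nat;
  Ny : nat;
  Nt : nat;
  F : R -> R;
  beta : R;
  eps_bounds : 0 < eps < 1;
  kappa_pos : 0 < kappa;
  theta_s_bounds : 0 <= theta_s <= PI;
  dt_pos : 0 < dt;
  dx_pos : 0 < dx;
  dy_pos : 0 < dy;
  Nx_pos : (0 < Nx)%nat;
  Ny_pos : (0 < Ny)%nat;
  Nt_pos : (0 < Nt)%nat;
  F_potential : is_potential F beta
}.

Definition c_F (p : parameters) : R :=
  RInt (fun x => sqrt (2 * F p x)) (- beta p) (beta p).

Definition g (p : parameters) (x : R) : R :=
  eps p * c_F p * cos (theta_s p) / (4 * beta p ^ 3)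
  * (x ^ 3 - 3 * beta p ^ 2 * x).

Definition pos_part (x : R) : R := Rmax x 0.

(** Nonpositive: [x = pos_part x + neg_part x]. *)
Definition neg_part (x : R) : R := Rmin x 0.

Definition mobility (x1 x2 : R) : R := pos_part (1 + x1) * pos_part (1 - x2).

Definition upwind_flux (v x1 x2 : R) : R :=
  pos_part v * mobility x1 x2 + neg_part v * mobility x2 x1.

Definition is_cell (p : parameters) (i j : nat) : Prop :=
  (1 <= i <= Nx p)%nat /\ (1 <= j <= Ny p)%nat.

(** Five-point Laplacian at a cell; since [1 <= i] and [1 <= j] there, the
    indices [i - 1] and [j - 1] may be [0] but are never truncated. *)
Definition discrete_laplacian (p : parameters) (u : nat -> nat -> R)
    (i j : nat) : R :=
  (u (i + 1)%nat j - 2 * u i j + u (i - 1)%nat j) / dx p ^ 2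
  + (u i (j + 1)%nat - 2 * u i j + u i (j - 1)%nat) / dy p ^ 2.

Definition cell_sum (p : parameters) (u : nat -> nat -> R) : R :=
  sum_n_m (fun i => sum_n_m (fun j => u i j) 1 (Ny p)) 1 (Nx p).

Definition substrate_sum (p : parameters) (u : nat -> R) : R :=
  sum_n_m u 1 (Nx p).

(** The first argument of every field is the time level.  Half-integer faces
    are indexed by the cell below them: [Jx n i j] and [Vx n i j] live on the
    face [(i + 1/2, j)], [Jy n i j] and [Vy n i j] on [(i, j + 1/2)].  [phi]
    also carries the ghost values, at [i = 0], [i = Nx + 1], [j = 0] and
    [j = Ny + 1].  Values outside these ranges are unconstrained. *)
Record solution (p : parameters) := {
  phi : nat -> nat -> nat -> R;
  mu : nat -> nat -> nat -> R;
  Jx : nat -> nat -> nat -> R;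
  Jy : nat -> nat -> nat -> R;
  Vx : nat -> nat -> nat -> R;
  Vy : nat -> nat -> nat -> R;
  xi : nat -> R;
  eta : nat -> R;

  conservation : forall n i j, (n < Nt p)%nat -> is_cell p i j ->
    phi (n + 1)%nat i j - phi n i j
    = - (dt p / dx p * (Jx (n + 1)%nat i j - Jx (n + 1)%nat (i - 1)%nat j)
         + dt p / dy p * (Jy (n + 1)%nat i j - Jy (n + 1)%nat i (j - 1)%nat));

  flux_x : forall n i j, (n < Nt p)%nat ->
    is_cell p i j -> is_cell p (i + 1) j ->
    Jx (n + 1)%nat i j
    = upwind_flux (Vx (n + 1)%nat i j)
        (phi (n + 1)%nat i j) (phi (n + 1)%nat (i + 1)%nat j);
  velocity_x : forall n i j, (n < Nt p)%nat ->
    is_cell p i j -> is_cell p (i + 1) j ->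
    Vx (n + 1)%nat i j
    = - (/ dx p * (mu (n + 1)%nat (i + 1)%nat j - mu (n + 1)%nat i j));

  flux_y : forall n i j, (n < Nt p)%nat ->
    is_cell p i j -> is_cell p i (j + 1) ->
    Jy (n + 1)%nat i j
    = upwind_flux (Vy (n + 1)%nat i j)
        (phi (n + 1)%nat i j) (phi (n + 1)%nat i (j + 1)%nat);
  velocity_y : forall n i j, (n < Nt p)%nat ->
    is_cell p i j -> is_cell p i (j + 1) ->
    Vy (n + 1)%nat i j
    = - (/ dy p * (mu (n + 1)%nat i (j + 1)%nat - mu (n + 1)%nat i j));

  no_flux_x : forall n j, (n < Nt p)%nat -> (1 <= j <= Ny p)%nat ->
    Jx (n + 1)%nat 0%nat j = 0 /\ Jx (n + 1)%nat (Nx p) j = 0;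
  no_flux_y : forall n i, (n < Nt p)%nat -> (1 <= i <= Nx p)%nat ->
    Jy (n + 1)%nat i 0%nat = 0 /\ Jy (n + 1)%nat i (Ny p) = 0;

  chemical_potential : forall n i j, (n < Nt p)%nat -> is_cell p i j ->
    mu (n + 1)%nat i j
    = - eps p ^ 2 * discrete_laplacian p (phi (n + 1)%nat) i j
      + xi (n + 1)%nat * Derive (F p) (phi (n + 1)%nat i j);

  ghost_x : forall n j, (n < Nt p)%nat -> (1 <= j <= Ny p)%nat ->
    phi (n + 1)%nat 0%nat j = phi (n + 1)%nat 1%nat j
    /\ phi (n + 1)%nat (Nx p + 1)%nat j = phi (n + 1)%nat (Nx p) j;
  ghost_top : forall n i, (n < Nt p)%nat -> (1 <= i <= Nx p)%nat ->
    phi (n + 1)%nat i (Ny p + 1)%nat = phi (n + 1)%nat i (Ny p);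
  ghost_substrate : forall n i, (n < Nt p)%nat -> (1 <= i <= Nx p)%nat ->
    phi (n + 1)%nat i 0%nat
    = (1 - dy p / (eps p ^ 2 * kappa p * dt p)) * phi (n + 1)%nat i 1%nat
      + dy p / (eps p ^ 2 * kappa p * dt p) * phi n i 1%nat
      - dy p / eps p ^ 2
        * (eta (n + 1)%nat * Derive (g p) (phi (n + 1)%nat i 1%nat));

  bulk_multiplier : forall n, (n < Nt p)%nat ->
    cell_sum p (fun i j => F p (phi (n + 1)%nat i j) - F p (phi n i j))
    = xi (n + 1)%nat
      * cell_sum p (fun i j =>
          Derive (F p) (phi (n + 1)%nat i j)
          * (phi (n + 1)%nat i j - phi n i j));
  wall_multiplier : forall n, (n < Nt p)%nat ->
    substrate_sum p (fun i =>
      g p (phi (n + 1)%nat i 1%nat) - g p (phi n i 1%nat))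
    = eta (n + 1)%nat
      * substrate_sum p (fun i =>
          Derive (g p) (phi (n + 1)%nat i 1%nat)
          * (phi (n + 1)%nat i 1%nat - phi n i 1%nat))
}.

Arguments phi {p} _ _ _ _.

(* Main.v *)
Require Import Defs.
From Stdlib Require Import Reals Lra Lia.
Open Scope R_scope.

(** The bound is local to a cell and comes from the upwinding alone.  If the
    new value of a cell were at most [-1], the factor [pos_part (1 + phi)] of
    the mobility would vanish and no flux could leave the cell
    ([upwind_flux_ge_0_of_empty_right] and [upwind_flux_le_0_of_empty_left]).
    By conservation the cell value would then not have decreased during the
    step, so the old value would be at most [-1] as well.  Symmetrically, a new
    value of at least [1] makes [pos_part (1 - phi)] vanish, no flux can enter,
    and the cell value cannot have increased.  It is essential here that the mobility
    is evaluated at the new time level: the cell that would violate the bound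
    is the one that closes its own faces.

    Walls need no separate treatment: a zero flux is an upwind flux with zero
    velocity, so all four faces of every cell carry an upwind flux
    ([flux_right_upwind] and its companions). *)

Lemma pos_part_ge_0 (x : R) : 0 <= pos_part x.
Proof. apply Rmax_r. Qed.

Lemma neg_part_le_0 (x : R) : neg_part x <= 0.
Proof. apply Rmin_r. Qed.

Lemma mobility_ge_0 (x1 x2 : R) : 0 <= mobility x1 x2.
Proof. apply Rmult_le_pos; apply pos_part_ge_0. Qed.

Lemma mobility_empty_source (x1 x2 : R) : x1 <= -1 -> mobility x1 x2 = 0.
Proof.
  intros h; unfold mobility, pos_part.
  rewrite (Rmax_right (1 + x1)) by lra; ring.
Qed.

Lemma mobility_full_target (x1 x2 : R) : 1 <= x2 -> mobility x1 x2 = 0.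
Proof.
  intros h; unfold mobility, pos_part.
  rewrite (Rmax_right (1 - x2)) by lra; ring.
Qed.

(** Lets a closed wall count as an upwind face. *)
Lemma upwind_flux_0 (x1 x2 : R) : upwind_flux 0 x1 x2 = 0.
Proof.
  unfold upwind_flux, pos_part, neg_part.
  rewrite Rmax_left, Rmin_left by lra; ring.
Qed.

Lemma upwind_flux_ge_0 (v x1 x2 : R) :
  mobility x2 x1 = 0 -> 0 <= upwind_flux v x1 x2.
Proof.
  intros h; unfold upwind_flux; rewrite h.
  pose proof (Rmult_le_pos _ _ (pos_part_ge_0 v) (mobility_ge_0 x1 x2)); lra.
Qed.

Lemma upwind_flux_le_0 (v x1 x2 : R) :
  mobility x1 x2 = 0 -> upwind_flux v x1 x2 <= 0.
Proof.
  intros h; unfold upwind_flux; rewrite h.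
  pose proof (neg_part_le_0 v); pose proof (mobility_ge_0 x2 x1); nra.
Qed.

(** An empty cell cannot feed its left face: leftward flux would need the
    mobility with that cell as its source. *)
Lemma upwind_flux_ge_0_of_empty_right (v x1 x2 : R) :
  x2 <= -1 -> 0 <= upwind_flux v x1 x2.
Proof. intros h; apply upwind_flux_ge_0, mobility_empty_source, h. Qed.

Lemma upwind_flux_le_0_of_empty_left (v x1 x2 : R) :
  x1 <= -1 -> upwind_flux v x1 x2 <= 0.
Proof. intros h; apply upwind_flux_le_0, mobility_empty_source, h. Qed.

(** A full cell cannot receive through its left face: rightward flux would
    need the mobility with that cell as its target. *)
Lemma upwind_flux_le_0_of_full_right (v x1 x2 : R) :
  1 <= x2 -> upwind_flux v x1 x2 <= 0.
Proof. intros h; apply upwind_flux_le_0, mobility_full_target, h. Qed.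

Lemma upwind_flux_ge_0_of_full_left (v x1 x2 : R) :
  1 <= x1 -> 0 <= upwind_flux v x1 x2.
Proof. intros h; apply upwind_flux_ge_0, mobility_full_target, h. Qed.

(** On each face the velocity and the neighbouring value can be left
    existential, because the sign of the flux is decided by the cell itself. *)
Lemma flux_right_upwind (p : parameters) (s : solution p) (n i j : nat) :
  (n < Nt p)%nat -> is_cell p i j ->
  exists v x, Jx p s (n + 1) i j = upwind_flux v (phi s (n + 1) i j) x.
Proof.
  intros hn hij; destruct hij as [hi hj].
  destruct (Nat.eq_dec i (Nx p)) as [-> | ne].
  - exists 0, 0; rewrite upwind_flux_0; now apply no_flux_x.
  - do 2 eexists; apply flux_x; unfold is_cell; lia.
Qed.

Lemma flux_left_upwind (p : parameters) (s : solution p) (n i j : nat) :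
  (n < Nt p)%nat -> is_cell p i j ->
  exists v x, Jx p s (n + 1) (i - 1) j = upwind_flux v x (phi s (n + 1) i j).
Proof.
  intros hn hij; destruct hij as [hi hj].
  destruct (Nat.eq_dec i 1) as [-> | ne].
  - exists 0, 0; rewrite upwind_flux_0; now apply no_flux_x.
  - exists (Vx p s (n + 1) (i - 1) j), (phi s (n + 1) (i - 1) j).
    rewrite flux_x by (unfold is_cell; lia).
    now replace (i - 1 + 1)%nat with i by lia.
Qed.

Lemma flux_top_upwind (p : parameters) (s : solution p) (n i j : nat) :
  (n < Nt p)%nat -> is_cell p i j ->
  exists v x, Jy p s (n + 1) i j = upwind_flux v (phi s (n + 1) i j) x.
Proof.
  intros hn hij; destruct hij as [hi hj].
  destruct (Nat.eq_dec j (Ny p)) as [-> | ne].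
  - exists 0, 0; rewrite upwind_flux_0; now apply no_flux_y.
  - do 2 eexists; apply flux_y; unfold is_cell; lia.
Qed.

Lemma flux_bottom_upwind (p : parameters) (s : solution p) (n i j : nat) :
  (n < Nt p)%nat -> is_cell p i j ->
  exists v x, Jy p s (n + 1) i (j - 1) = upwind_flux v x (phi s (n + 1) i j).
Proof.
  intros hn hij; destruct hij as [hi hj].
  destruct (Nat.eq_dec j 1) as [-> | ne].
  - exists 0, 0; rewrite upwind_flux_0; now apply no_flux_y.
  - exists (Vy p s (n + 1) i (j - 1)), (phi s (n + 1) i (j - 1)).
    rewrite flux_y by (unfold is_cell; lia).
    now replace (j - 1 + 1)%nat with j by lia.
Qed.

(** Interior and wall cells in one form, so that each bound is a single sign
    argument.  The weights [a] and [b] are the mesh ratios [dt / dx] and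
    [dt / dy]. *)
Lemma cell_update_upwind (p : parameters) (s : solution p) (n i j : nat) :
  (n < Nt p)%nat -> is_cell p i j ->
  exists a b vr xr vl xl vt xt vb xb, 0 < a /\ 0 < b /\
    let c := phi s (n + 1) i j in
    c - phi s n i j
    = a * (upwind_flux vl xl c - upwind_flux vr c xr)
      + b * (upwind_flux vb xb c - upwind_flux vt c xt).
Proof.
  intros hn hij.
  destruct (flux_right_upwind p s n i j hn hij) as (vr & xr & hr).
  destruct (flux_left_upwind p s n i j hn hij) as (vl & xl & hl).
  destruct (flux_top_upwind p s n i j hn hij) as (vt & xt & ht).
  destruct (flux_bottom_upwind p s n i j hn hij) as (vb & xb & hb).
  exists (dt p / dx p), (dt p / dy p), vr, xr, vl, xl, vt, xt, vb, xb.
  split; [| split].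
  - apply Rdiv_lt_0_compat; [apply dt_pos | apply dx_pos].
  - apply Rdiv_lt_0_compat; [apply dt_pos | apply dy_pos].
  - cbv zeta; rewrite <- hr, <- hl, <- ht, <- hb.
    rewrite (conservation p s n i j hn hij); ring.
Qed.

Lemma empty_cell_not_drained (p : parameters) (s : solution p) (n i j : nat) :
  (n < Nt p)%nat -> is_cell p i j -> phi s (n + 1) i j <= -1 ->
  phi s n i j <= phi s (n + 1) i j.
Proof.
  intros hn hij hc.
  destruct (cell_update_upwind p s n i j hn hij)
    as (a & b & vr & xr & vl & xl & vt & xt & vb & xb & ha & hb & e).
  cbv zeta in e.
  pose proof (upwind_flux_le_0_of_empty_left vr _ xr hc).
  pose proof (upwind_flux_ge_0_of_empty_right vl xl _ hc).
  pose proof (upwind_flux_le_0_of_empty_left vt _ xt hc).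
  pose proof (upwind_flux_ge_0_of_empty_right vb xb _ hc).
  nra.
Qed.

Lemma full_cell_not_filled (p : parameters) (s : solution p) (n i j : nat) :
  (n < Nt p)%nat -> is_cell p i j -> 1 <= phi s (n + 1) i j ->
  phi s (n + 1) i j <= phi s n i j.
Proof.
  intros hn hij hc.
  destruct (cell_update_upwind p s n i j hn hij)
    as (a & b & vr & xr & vl & xl & vt & xt & vb & xb & ha & hb & e).
  cbv zeta in e.
  pose proof (upwind_flux_ge_0_of_full_left vr _ xr hc).
  pose proof (upwind_flux_le_0_of_full_right vl xl _ hc).
  pose proof (upwind_flux_ge_0_of_full_left vt _ xt hc).
  pose proof (upwind_flux_le_0_of_full_right vb xb _ hc).
  nra.
Qed.

Theorem theorem1 (p : parameters) (s : solution p) (n i j : nat)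
    (hn : (n < Nt p)%nat) (hij : is_cell p i j)
    (hphi : Rabs (phi s n i j) < 1) :
  Rabs (phi s (n + 1) i j) < 1.
Proof.
  apply Rabs_def2 in hphi; destruct hphi as [hlt hgt].
  apply Rabs_def1; apply Rnot_le_lt; intros hc.
  - pose proof (full_cell_not_filled p s n i j hn hij hc); lra.
  - pose proof (empty_cell_not_drained p s n i j hn hij hc); lra.
Qed.
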